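(* For every workload $\mathcal T$ with global balancing ratio $\beta$, Algorithm Clairvoyant satisfies $$CR_{Clairvoyant}(\mathcal T)\le 32\,\ell\sqrt{s/\beta}+1=O\!\left(\ell\sqrt{s/\beta}\right).$$ In particular, for balanced workloads ($\beta=\Theta(1)$) with $\ell=O(1)$, $CR_{Clairvoyant}(\mathcal T)=O(\sqrt s)$.
   Context: Model. A workload is a set $\mathcal T=\{T_1,\dots,T_n\}$ of $n\ge1$ transactions (one per thread), all issued at time $0$, over a set $\mathcal R=\{R_1,\dots,R_s\}$ of $s$ shared resources. Each transaction $T$ reads the resources in $\mathcal R_r(T)$ and writes those in $\mathcal R_w(T)$; $\mathcal R(T)=\mathcal R_r(T)\cup\mathcal R_w(T)$, $\lambda(T)=|\mathcal R(T)|\ge1$, $\lambda_w(T)=|\mathcal R_w(T)|$. $T$ is read-only if $\lambda_w(T)=0$ and writing otherwise; at least one transaction is writing. Transactions $T,T'$ conflict if some resource lies in $(\mathcal R_w(T)\cap\mathcal R(T'))\cup(\mathcal R(T)\cap\mathcal R_w(T'))$; the conflict graph has the transactions as vertices and an edge between each conflicting pair. Time is discrete and synchronous; each transaction $T_i$ has a fixed integer execution time $\tau_i\ge1$ and commits once it has executed $\tau_i$ consecutive time steps without being aborted. Whenever two running transactions conflict, the contention manager aborts one of them; an aborted transaction restarts immediately from scratch (greedy schedule). The makespan of an algorithm on a workload is the time until all its transactions have committed; $\mathrm{makespan}_{opt}$ is the minimum makespan of any schedule in which conflicting transactions never execute simultaneously (optimal offline scheduler); the competitive ratio is $CR_{\mathcal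 A}=\mathrm{makespan}_{\mathcal A}/\mathrm{makespan}_{opt}$. The balancing ratio of a writing transaction is $\beta(T)=\lambda_w(T)/\lambda(T)\in[1/s,1]$; the global balancing ratio $\beta$ is the minimum of $\beta(T)$ over writing transactions. $\tau_{\max}=\max_i\tau_i$, $\tau_{\min}=\min_i\tau_i$, $\ell=\lceil\log_2(\tau_{\max}/\tau_{\min})\rceil+1$. Grouping. Writing transactions are partitioned into groups $A_0,\dots,A_{\ell-1}$, where $A_i$ contains those with execution time in $[2^i\tau_{\min},(2^{i+1}-1)\tau_{\min}]$; each $A_i$ is partitioned into subgroups $A_i^0,\dots,A_i^{\kappa-1}$, $\kappa=\lceil\log_2 s\rceil+1$, where $A_i^j$ contains those $T$ with $\lambda(T)\in[\lambda^j_{\min},\lambda^j_{\max}]$, $\lambda^j_{\min}=2^j$, $\lambda^j_{\max}=2^{j+1}-1$. Read-only transactions form a group $B$. Subgroups are ordered by $A_i^j<A_k^l$ iff $i<k$ or ($i=k$ and $j<l$), and $B$ is placed after all subgroups. Algorithm Clairvoyant. At each time step $t$: let $\mathcal T_t$ be the set of pending (not yet committed) transactions; $\hat A_t$ the lowest-order subgroup (or $B$) containing pending transactions; $\hat{\mathcal T}_t$ the pending transactions of $\hat A_t$; $\hat S_t\subseteq\hat{\mathcal T}_t$ those that started their current execution before $t$ and have neither committed nor been aborted; $\hat S'_t$ the transactions of $\mathcal T_t$ conflicting with some transaction of $\hat S_t$; $\hat I_t$ a maximal independent set of the conflict graph induced on $\hat{\mathcal T}_t\setminus\hat S'_t$.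 Transactions in $\Pi^h_t=\hat I_t\cup\hat S_t$ get high priority, all others in $\mathcal T_t$ get low priority. All pending transactions execute; on a conflict, a high-priority transaction aborts a low-priority one, and conflicts between transactions of equal priority are resolved arbitrarily.
   Formalization: Group A_i is taken as execution times in [2^i τ_min, 2^{i+1} τ_min), since the stated intervals leave gaps (τ_min=2, τ=3 is in no group); the closing O(·) remarks, immediate from the explicit bound, are not stated. *)

(* Defs.v *)
From Stdlib Require Import Reals.
From mathcomp Require Import all_boot.

Set Implicit Arguments.
Unset Strict Implicit.
Unset Printing Implicit Defensive.

Section Model.

(* n transactions indexed by 'I_n, s resources indexed by 'I_s. *)
Variables (n s : nat) (Rr Rw : 'I_n -> {set 'I_s}) (tau : 'I_n -> nat).

Definition Rset (i : 'I_n) : {set 'I_s} := Rr i :|: Rw i.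
Definition lam (i : 'I_n) : nat := #|Rset i|.
Definition lamw (i : 'I_n) : nat := #|Rw i|.
Definition writing (i : 'I_n) : bool := 0 < lamw i.

Definition conflict (i j : 'I_n) : bool :=
  (i != j) &&
  [exists r, ((r \in Rw i) && (r \in Rset j)) || ((r \in Rset i) && (r \in Rw j))].

Definition independent (A : {set 'I_n}) : bool :=
  [forall x in A, forall y in A, ~~ conflict x y].

Definition mis (C I : {set 'I_n}) : bool :=
  [&& I \subset C, independent I &
      [forall x in C :\: I, exists y in I, conflict x y]].

Definition tau_max : nat := \max_(i < n) tau i.
Definition tau_min : nat := \big[minn/tau_max]_(i < n) tau i.

(* ell_pred e <-> tau_max <= 2^e * tau_min  (the disjunct tau_min == 0 only
   makes the minimum well defined; it is vacuous since all tau_i >= 1). *)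
Definition ell_pred (e : nat) : bool := (tau_max <= 2 ^ e * tau_min) || (tau_min == 0).

Lemma ell_pred_ex : exists e, ell_pred e.
Proof.
exists tau_max; rewrite /ell_pred; case: (posnP tau_min) => [->|H]; first by rewrite orbT.
apply/orP; left; apply: (leq_trans (ltnW (ltn_expl tau_max (ltnSn 1)))).
by rewrite -{1}(muln1 (2 ^ tau_max)) leq_mul2l H orbT.
Qed.

(* ceil(log2(tau_max / tau_min)) = least e with tau_max <= 2^e tau_min *)
Definition ell_exp : nat := ex_minn ell_pred_ex.
Definition ell : nat := ell_exp.+1.

(* Group index i: 2^i tau_min <= tau < 2^(i+1) tau_min;
   subgroup index j: 2^j <= lambda <= 2^(j+1) - 1. *)
Definition grp (i : 'I_n) : nat := trunc_log 2 (tau i %/ tau_min).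
Definition sub (i : 'I_n) : nat := trunc_log 2 (lam i).

(* Key of the (sub)group of a transaction: Some (i, j) for A_i^j, None for B. *)
Definition key (i : 'I_n) : option (nat * nat) :=
  if writing i then Some (grp i, sub i) else None.

Definition key_le (a b : option (nat * nat)) : bool :=
  match a, b with
  | Some (g1, j1), Some (g2, j2) => (g1 < g2) || ((g1 == g2) && (j1 <= j2))
  | Some _, None => true
  | None, Some _ => false
  | None, None => true
  end.

(* Execution state.  surv t = transactions that execute step t without being
   aborted.  st surv t i = None if i has committed before step t, Some p if
   it is pending and has executed p consecutive unaborted steps in its
   current execution. *)
Fixpoint st (surv : nat -> {set 'I_n}) (t : nat) (i : 'I_n) : option nat :=
  match t with
  | 0 => Some 0
  | t'.+1 =>
      match st surv t' i with
      | None => None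
      | Some p =>
          if i \in surv t' then (if tau i <= p.+1 then None else Some p.+1)
          else Some 0
      end
  end.

Definition pending surv t : {set 'I_n} := [set i | st surv t i != None].

Definition hatT surv t : {set 'I_n} :=
  [set i in pending surv t | [forall j in pending surv t, key_le (key i) (key j)]].

(* \hat S_t : those that started their current execution before t and have
   neither committed nor been aborted. *)
Definition hatS surv t : {set 'I_n} :=
  [set i in hatT surv t | if st surv t i is Some p then 0 < p else false].

Definition hatS' surv t : {set 'I_n} :=
  [set j in pending surv t | [exists k in hatS surv t, conflict j k]].

Definition high surv (I : nat -> {set 'I_n}) t : {set 'I_n} := I t :|: hatS surv t.

(* One step of Algorithm Clairvoyant: I t is a maximal independent set of the
   conflict graph induced on \hat T_t \ \hat S'_t; the survivors are pairwise
   non-conflicting; a transaction is aborted only because of a conflict with a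
   pending transaction of at least its priority; and a high-priority
   transaction always aborts a conflicting low-priority one. *)
Definition clairvoyant_step surv (I : nat -> {set 'I_n}) t : bool :=
  [&& mis (hatT surv t :\: hatS' surv t) (I t),
      surv t \subset pending surv t,
      independent (surv t),
      [forall x in pending surv t :\: surv t, exists y in pending surv t,
          conflict x y && ((y \in high surv I t) || (x \notin high surv I t))] &
      [forall x in pending surv t, forall y in pending surv t,
          [&& conflict x y, x \in high surv I t & y \notin high surv I t]
            ==> (y \notin surv t)]].

Definition clairvoyant_run surv (I : nat -> {set 'I_n}) : Prop :=
  forall t, clairvoyant_step surv I t.

(* Offline schedules: start times sigma, each transaction runs during
   [sigma i, sigma i + tau i); conflicting ones never overlap. *)
Definition valid_schedule (sigma : 'I_n -> nat) : Prop :=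
  forall i j, conflict i j -> (sigma i + tau i <= sigma j) || (sigma j + tau j <= sigma i).

Definition sched_makespan (sigma : 'I_n -> nat) : nat := \max_(i < n) (sigma i + tau i).

End Model.

(* Main.v *)
(** Let [M] be the makespan of the offline schedule.  High-priority transactions
    are independent and keep running until they commit, so while a subgroup is the
    lowest pending one, each of its transactions either runs or is blocked by a
    running neighbour in the subgroup.  The writers of one resource conflict
    pairwise, so their execution times sum to at most [M].

    For the subgroup [A_i^j] put [L = 2 ^ j] and let [U] be the total execution time
    of its pending transactions.  Since each of them writes at least [beta L]
    resources, [U <= s M / (beta L)], and the subgroup is finished within [U] steps.
    On the other hand the execution times of the transactions that write into the
    resources of a given one sum to at most [D = 2 L M]; double counting the
    conflicting pairs then shows that [2 D] steps halve [U].  (A bound [O (D)] for the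
    duration of the phase fails: readers of a resource written by [T] need not
    conflict with each other.)  With [Q = sqrt (s / beta)], halving about
    [2 log2 (Q / L)] times first when [L < Q], the durations over all [j] sum to at
    most [22 Q M].  The final read-only group takes at most [tau_max <= M] steps. *)

Require Import Defs.
From Stdlib Require Import Reals Lra.
From mathcomp Require Import all_boot zify.

Set Implicit Arguments.
Unset Strict Implicit.
Unset Printing Implicit Defensive.

(* zify pulls in MathComp's ring_scope, which takes over the key R. *)
Delimit Scope R_scope with R.

Lemma key_le_anti a b : key_le a b -> key_le b a -> a = b.
Proof.
case: a b => [[g j]|] [[g' j']|] //= H1 H2.
by have [-> ->] : g = g' /\ j = j' by lia.
Qed.

(** Adding each sum to its transpose reduces the claim to unordered pairs. This is needed because
    the charge for a conflicting pair may fall on either member. *)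
Lemma leq_sum_sym (T : finType) (A : {set T}) (f g : T -> T -> nat) :
  (forall x y, x \in A -> y \in A -> f x y + f y x <= g x y + g y x) ->
  \sum_(x in A) \sum_(y in A) f x y <= \sum_(x in A) \sum_(y in A) g x y.
Proof.
move=> fg; rewrite -leq_double -!addnn.
rewrite [X in _ + X <= _]exchange_big [X in _ <= _ + X]exchange_big -!big_split /=.
apply: leq_sum => x xA; rewrite -!big_split /=; apply: leq_sum => y yA; exact: fg.
Qed.

(** * Runs of the algorithm: the high-priority set *)

Section Run.

Variables (n s : nat) (Rr Rw : 'I_n -> {set 'I_s}) (tau : 'I_n -> nat).
Variables (surv I : nat -> {set 'I_n}).

Local Notation conf := (conflict Rr Rw).
Local Notation pend := (pending tau surv).
Local Notation hT := (hatT Rr Rw tau surv).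
Local Notation hS := (hatS Rr Rw tau surv).
Local Notation hi := (high Rr Rw tau surv I).
Local Notation kof := (key Rr Rw tau).

Lemma conflictC x y : conf x y = conf y x.
Proof.
rewrite /conflict eq_sym; congr (_ && _); apply: eq_existsb => r.
by rewrite orbC andbC [X in _ || X]andbC.
Qed.

Lemma pendingS x t : x \in pend t.+1 -> x \in pend t.
Proof. by rewrite !inE /=; case: (st tau surv t x). Qed.

Lemma pending_mono x t t' : t <= t' -> x \in pend t' -> x \in pend t.
Proof.
by elim: t' => [|t' IH]; [case: t | rewrite leq_eqVlt => /predU1P[->//|/IH H /pendingS /H]].
Qed.

Lemma hatT_pending x t : x \in hT t -> x \in pend t.
Proof. by rewrite inE => /andP[]. Qed.

Lemma hatT_keyE x y t : x \in hT t -> y \in hT t -> kof x = kof y.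
Proof.
rewrite !inE => /andP[px /forallP hx] /andP[py /forallP hy].
by apply: key_le_anti; [move: (hx y); rewrite !inE py | move: (hy x); rewrite !inE px].
Qed.

Lemma hatT_minimal x t :
  x \in pend t -> (forall y, y \in pend t -> key_le (kof x) (kof y)) -> x \in hT t.
Proof. by move=> px hx; rewrite inE px; apply/forall_inP. Qed.

Lemma hatTS x t : x \in hT t -> x \in pend t.+1 -> x \in hT t.+1.
Proof.
rewrite inE => /andP[_ /forall_inP hx] px; apply: hatT_minimal => // y /pendingS; exact: hx.
Qed.

Hypothesis run : clairvoyant_run Rr Rw tau surv I.

Lemma run_step t :
  [/\ mis Rr Rw (hT t :\: hatS' Rr Rw tau surv t) (I t),
      independent Rr Rw (surv t) &
      forall x, x \in pend t -> x \notin surv t ->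
        exists2 y, conf x y & (y \in hi t) || (x \notin hi t)].
Proof.
have /and5P[H1 _ H2 /forall_inP H3 _] := run t.
split=> // x px sx.
have /H3 /exists_inP[y _ /andP[cxy yh]] : x \in pend t :\: surv t by rewrite inE px sx.
by exists y.
Qed.

Lemma independentP (A : {set 'I_n}) x y :
  independent Rr Rw A -> x \in A -> y \in A -> ~~ conf x y.
Proof. by move=> /forall_inP h xA; move/forall_inP: (h x xA); apply. Qed.

Lemma hatS_st x t : x \in hS t -> exists2 p, st tau surv t x = Some p & 0 < p.
Proof. by rewrite inE => /andP[_]; case: st => [p|] // ?; exists p. Qed.

(** Positive progress means survival of the previous step, and survivors do not conflict; at step 0
    nobody has progress. *)
Lemma hatS_independent x y t : x \in hS t -> y \in hS t -> ~~ conf x y.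
Proof.
case: t => [|t] /hatS_st[p Ep p0] /hatS_st[q Eq q0]; first by case: Ep p0 => <-.
have insurv z r : st tau surv t.+1 z = Some r -> 0 < r -> z \in surv t.
  by move=> /=; case: (st tau surv t z) => // q1; case: (z \in surv t) => // -[<-].
have [_ ind _] := run_step t.
by apply: (independentP ind); [apply: insurv Ep p0 | apply: insurv Eq q0].
Qed.

Lemma hatS_hatT x t : x \in hS t -> x \in hT t.
Proof. by rewrite inE => /andP[]. Qed.

(* A member of hatS missing from I t would conflict with a member of I t, which
   then lies in hatS'. *)
Lemma highE t : hi t = I t.
Proof.
have [/and3P[sub ind /forall_inP mx] _ _] := run_step t.
apply/setUidPl/subsetP => x xS; apply/negPn/negP => xI.
have xC : x \in (hT t :\: hatS' Rr Rw tau surv t) :\: I t.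
  rewrite !in_setD xI hatS_hatT // andbT /= inE negb_and; apply/orP; right.
  by apply/negP => /exists_inP[y yS]; apply/negP; exact: hatS_independent yS.
have /exists_inP[y yI cxy] := mx x xC.
have : y \in hT t :\: hatS' Rr Rw tau surv t by apply: (subsetP sub).
rewrite in_setD inE => /andP[/negP yS' /hatT_pending py]; apply: yS'.
by rewrite py; apply/exists_inP; exists x => //; rewrite conflictC.
Qed.

Lemma hatS_high x t : x \in hS t -> x \in hi t.
Proof. by move=> xS; rewrite inE xS orbT. Qed.

Lemma high_independent x y t : x \in hi t -> y \in hi t -> ~~ conf x y.
Proof.
rewrite highE; have [/and3P[_ ind _] _ _] := run_step t; exact: independentP.
Qed.

Lemma high_hatT x t : x \in hi t -> x \in hT t.
Proof.
rewrite highE; have [/and3P[/subsetP sub _ _] _ _] := run_step t.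
by move/sub; rewrite in_setD => /andP[].
Qed.

(** Aborting a high-priority transaction takes a conflicting one that is also high, against
    independence. *)
Lemma high_surv x t : x \in hi t -> x \in surv t.
Proof.
move=> xh; apply/negPn/negP => xs; have [_ _ ab] := run_step t.
have [y cxy] := ab x (hatT_pending (high_hatT xh)) xs.
by rewrite xh orbF => /(high_independent xh); rewrite cxy.
Qed.

(** Outside [hatS'] this is maximality of [I t]; inside it, the neighbour in [hatS] is high. *)
Lemma hatT_high_or_blocked x t :
  x \in hT t -> (x \in hi t) || [exists y in hi t, conf x y].
Proof.
move=> xT; case: (boolP (x \in hi t)) => //= xh; apply/exists_inP.
have [/and3P[_ _ /forall_inP mx] _ _] := run_step t.
case: (boolP (x \in hatS' Rr Rw tau surv t)) => [|xS'].
  by rewrite inE => /andP[_ /exists_inP[y /hatS_high yh cxy]]; exists y.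
have /mx/exists_inP[y yI cxy] : x \in (hT t :\: hatS' Rr Rw tau surv t) :\: I t.
  by rewrite !in_setD -highE xh xS'.
by exists y; rewrite // highE.
Qed.

(** * High-priority steps and progress *)

Definition high_time x t := \sum_(u < t) (x \in hi u).

(** Once high, [x] stays in [hatT] and in [hatS], hence high, until it commits. So its high-priority
    steps all belong to one execution. The [hatT] conjunct carries the induction. *)
Lemma high_time_progress x t : 0 < tau x ->
  if st tau surv t x is Some p then
    high_time x t <= p /\ (0 < high_time x t -> x \in hT t) /\ p < tau x
  else high_time x t <= tau x.
Proof.
move=> tx; rewrite /high_time; elim: t => [|t]; first by rewrite /= big_ord0.
rewrite big_ord_recr /=; set h := \sum_(u < t) _.
case E: (st tau surv t x) => [p|]; last first.
  case: (boolP (x \in hi t)) => [/high_hatT/hatT_pending|]; last by rewrite addn0.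
  by rewrite inE E.
move=> [hp [hT' ptau]]; case: (boolP (x \in hi t)) => xh.
  rewrite high_surv //; case: ifP => tp; first lia.
  split; first lia; split; last lia.
  move=> _; apply: hatTS; first exact: high_hatT.
  by rewrite inE /= E high_surv // tp.
(* An earlier high-priority step would put [x] in [hatS], making it high now. *)
have h0 : h = 0.
  apply/eqP/negPn; rewrite -lt0n; apply/negP => h0; case/negP: xh.
  by apply: hatS_high; rewrite inE hT' // E; lia.
by rewrite h0 /=; case: ifP => _ //; case: ifP => //; lia.
Qed.

Hypothesis tau_gt0 : forall x, 0 < tau x.

Lemma high_time_le x t : high_time x t <= tau x.
Proof.
have := high_time_progress t (tau_gt0 x).
by case: st => [p [? [_ ?]]|//]; lia.
Qed.

Lemma high_time_hatS x t : x \in pend t -> 0 < high_time x t -> x \in hS t.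
Proof.
move=> px h0; rewrite [_ \in hS t]inE; have := high_time_progress t (tau_gt0 x).
rewrite inE in px; case: (st tau surv t x) px => // p _ [hp [hx _]].
by rewrite hx //=; lia.
Qed.

Lemma sum_high_le x a b : a <= b -> \sum_(a <= u < b) (x \in hi u) <= high_time x b.
Proof.
by move=> ab; rewrite /high_time -(big_mkord xpredT (fun u => (x \in hi u) : nat))
  (big_cat_nat (leq0n a) ab) /= leq_addl.
Qed.

Lemma leq_sum_high_tau x a b : \sum_(a <= u < b) (x \in hi u) <= tau x.
Proof.
case: (leqP a b) => [ab|/ltnW ba]; last by rewrite big_geq.
exact: leq_trans (sum_high_le x ab) (high_time_le x b).
Qed.

(** * Duration of one phase *)

Definition subpending k t : {set 'I_n} := [set x in pend t | kof x == k].

Definition work k t := \sum_(x in subpending k t) tau x.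

(** All subgroups before [k] are finished; [k] itself may be empty, so phases chain through empty
    subgroups. *)
Definition reached k t := forall x, x \in pend t -> key_le k (kof x).

(** One direction of a conflict, with [x = y] allowed so that a writer counts towards its own
    load. *)
Definition writes_into x y := [exists r, (r \in Rw x) && (r \in Defs.Rset Rr Rw y)].

Lemma reached_mono k t t' : t <= t' -> reached k t -> reached k t'.
Proof. by move=> tt' rk x /(pending_mono tt')/rk. Qed.

Lemma subpending_mono k t t' x : t <= t' -> x \in subpending k t' -> x \in subpending k t.
Proof. by move=> tt'; rewrite ![_ \in subpending _ _]inE => /andP[/(pending_mono tt')-> ->]. Qed.

Lemma subpending_hatT k t x : reached k t -> x \in subpending k t -> x \in hT t.
Proof.
move=> rk; rewrite inE => /andP[px /eqP kx]; apply: hatT_minimal => // y.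
by rewrite kx; apply: rk.
Qed.

Lemma hatT_subpending k t x y :
  reached k t -> x \in subpending k t -> y \in hT t -> y \in subpending k t.
Proof.
move=> rk xk yT; rewrite inE hatT_pending //=.
rewrite -(hatT_keyE (subpending_hatT rk xk) yT).
by move: xk; rewrite inE => /andP[].
Qed.

Lemma subpending_blocked k a u x : reached k a -> a <= u -> x \in subpending k u ->
  0 < \sum_(y in subpending k a) ((x == y) || conf x y) * (y \in hi u).
Proof.
move=> ra au xk; have ru := reached_mono au ra.
have [y yh adj] : exists2 y, y \in hi u & (x == y) || conf x y.
  have /orP[xh|/exists_inP[y yh cxy]] := hatT_high_or_blocked (subpending_hatT ru xk).
    by exists x => //; rewrite eqxx.
  by exists y => //; rewrite cxy orbT.
have yA : y \in subpending k a.
  exact: subpending_mono au (hatT_subpending ru xk (high_hatT yh)).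
by rewrite (bigD1 y) //= adj yh.
Qed.

Lemma subpending_wait k a b x : reached k a -> x \in subpending k b ->
  b.+1 - a <= \sum_(y in subpending k a) ((x == y) || conf x y) *
                 \sum_(a <= u < b.+1) (y \in hi u).
Proof.
move=> ra xk; rewrite -[b.+1 - a]muln1 -sum_nat_const_nat.
under [X in _ <= X]eq_bigr => y _ do rewrite big_distrr /=.
rewrite exchange_big /= !big_nat; apply: leq_sum => u /andP[au ub].
by apply: subpending_blocked => //; apply: subpending_mono xk.
Qed.

Lemma subpending_work k a : reached k a -> subpending k (a + work k a) = set0.
Proof.
move=> ra; apply/setP => x; rewrite [RHS]inE; apply/negbTE/negP => xk.
have := subpending_wait ra xk; rewrite -addnS addKn.
(* A transaction pending at [a + work k a] has waited through [work k a + 1] steps, each using a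
   high-priority step of the subgroup; only [work k a] of these exist. *)
suff : \sum_(y in subpending k a) ((x == y) || conf x y) *
         \sum_(a <= u < (a + work k a).+1) (y \in hi u) <= work k a by rewrite addnS; lia.
apply: leq_sum => y _; apply: leq_trans (leq_sum_high_tau y a (a + work k a).+1).
by case: (_ || _); rewrite ?mul1n.
Qed.

Lemma writes_into_conflict x y : conf x y -> writes_into x y || writes_into y x.
Proof.
case/andP => _ /existsP[r /orP[]/andP[rx ry]]; apply/orP; [left|right];
  by apply/existsP; exists r; rewrite rx ry.
Qed.

Lemma writes_into_refl x : writing Rw x -> writes_into x x.
Proof.
rewrite /writing /lamw card_gt0 => /set0Pn[r rx].
by apply/existsP; exists r; rewrite rx inE rx orbT.
Qed.

Lemma pending_high x a b :
  x \in pend b -> 0 < \sum_(a <= u < b.+1) (x \in hi u) -> x \in hi b.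
Proof.
move=> px; case: (leqP a b) => [ab|ba]; last by rewrite big_geq.
rewrite big_nat_recr //= addn_gt0 lt0b => /orP[h0|//].
apply/hatS_high/high_time_hatS => //; exact: leq_trans (sum_high_le x ab).
Qed.

(* Weigh a pending x by tau x and count the high-priority steps of its neighbours.
   Two conflicting transactions cannot both have run with high priority and both
   be pending, so each conflicting pair is charged once, for at most tau x * tau y;
   charging it to a member whose resources the other one writes gives the factor D. *)
Lemma work_decay k a d D : reached k a ->
  (forall x, kof x = k -> writing Rw x) ->
  (forall y, kof y = k -> \sum_(x | writes_into x y) tau x <= D) ->
  d * work k (a + d) <= D * work k a.
Proof.
move=> ra wk hD; set b := a + d; set A := subpending k a; set B := subpending k b.
have ab : a <= b by rewrite leq_addr.
have BA x : x \in B -> x \in A by apply: subpending_mono.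
have kA x : x \in A -> kof x = k by rewrite inE => /andP[_ /eqP].
pose h y := \sum_(a <= u < b.+1) (y \in hi u).
pose f x y := (x \in B) * ((x == y) || conf x y) * (tau x * h y).
pose g x y := writes_into x y * (tau x * tau y).
apply: (@leq_trans (\sum_(x in A) \sum_(y in A) f x y)).
  rewrite /work -/B big_distrr /= big_mkcond [X in _ <= X]big_mkcond /=.
  apply: leq_sum => x _; case: ifP => // xB; rewrite (BA x xB).
  have wait := subpending_wait ra xB.
  apply: (@leq_trans (tau x * \sum_(y in A) ((x == y) || conf x y) * h y)).
    rewrite mulnC leq_mul2l; apply/orP; right; apply: leq_trans wait.
    by rewrite /b -addnS addKn.
  rewrite big_distrr /=; apply: leq_sum => y _; rewrite /f xB mul1n.
  by rewrite mulnCA.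
apply: (@leq_trans (\sum_(x in A) \sum_(y in A) g x y)).
  apply: leq_sum_sym => x y xA yA; rewrite /f /g [conf y x]conflictC [y == x]eq_sym.
  have hx : h x <= tau x by apply: leq_sum_high_tau.
  have hy : h y <= tau y by apply: leq_sum_high_tau.
  have mxy : tau x * h y <= tau x * tau y by rewrite leq_mul.
  have myx : tau y * h x <= tau x * tau y by rewrite mulnC leq_mul.
  rewrite [tau y * tau x]mulnC.
  case: (eqVneq x y) hx hy mxy myx => [<-|nxy] hx hy mxy myx.
    rewrite (writes_into_refl (wk x (kA x xA))) orTb muln1 mul1n.
    by case: (x \in B); rewrite ?mul1n ?mul0n //; lia.
  case: (boolP (conf x y)) => [cxy|_]; last by rewrite /= !muln0 !mul0n.
  have : tau x * tau y <= writes_into x y * (tau x * tau y) + writes_into y x * (tau x * tau y).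
    by case/orP: (writes_into_conflict cxy) => ->; rewrite mul1n (leq_addr, leq_addl).
  apply: leq_trans; rewrite /= !muln1.
  have bothB : x \in B -> y \in B -> (h x == 0) || (h y == 0).
    rewrite ![_ \in B]inE => /andP[px _] /andP[py _]; apply/negPn.
    rewrite negb_or -!lt0n; apply/negP => /andP[/(pending_high px) xh /(pending_high py) yh].
    by have := high_independent xh yh; rewrite cxy.
  case: (x \in B) (y \in B) bothB => [] [] // bothB; rewrite ?mul1n ?mul0n ?addn0 ?add0n //.
  by case/orP: (bothB isT isT) => /eqP h0; rewrite h0 muln0 ?addn0.
rewrite exchange_big /= /work big_distrr /=; apply: leq_sum => y yA.
rewrite /g; apply: (@leq_trans (tau y * \sum_(x | writes_into x y) tau x)).
  rewrite big_distrr /= big_mkcond [X in _ <= X]big_mkcond /=.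
  apply: leq_sum => x _; case: (x \in A) => //; case: (writes_into x y) => //.
  by rewrite mul1n mulnC.
by rewrite mulnC leq_mul // hD // kA.
Qed.

(** Each round is [work_decay] with [d = 2 * D], after cancelling [D]. *)
Lemma work_halving k a m D : reached k a -> 0 < D ->
  (forall x, kof x = k -> writing Rw x) ->
  (forall y, kof y = k -> \sum_(x | writes_into x y) tau x <= D) ->
  2 ^ m * work k (a + m * (2 * D)) <= work k a.
Proof.
move=> ra D0 wk hD; elim: m => [|m IH]; first by rewrite mul0n addn0 mul1n.
apply: leq_trans IH; rewrite expnS -mulnA mulnCA leq_mul2l; apply/orP; right.
have := work_decay (2 * D) (reached_mono (leq_addr (m * (2 * D)) a) ra) wk hD.
rewrite -addnA -mulSnr -[X in X <= _]mulnA mulnCA leq_mul2l.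
by case/orP => // /eqP D00; rewrite D00 in D0.
Qed.

(** After [m] halvings, the work still left serves as the bound [w] on the remaining time. *)
Lemma phase_end k a m D : reached k a -> 0 < D ->
  (forall x, kof x = k -> writing Rw x) ->
  (forall y, kof y = k -> \sum_(x | writes_into x y) tau x <= D) ->
  exists w, subpending k (a + m * (2 * D) + w) = set0 /\ 2 ^ m * w <= work k a.
Proof.
move=> ra D0 wk hD; exists (work k (a + m * (2 * D))); split; last exact: work_halving.
by apply: subpending_work; apply: reached_mono ra; apply: leq_addr.
Qed.

(** Read-only transactions never conflict, so a pending one is high at every step; [T + 1] such
    steps would exceed its execution time. *)
Lemma readonly_phase_end a T : reached None a -> (forall x, tau x <= T) -> pend (a + T) = set0.
Proof.
move=> ra tT; apply/setP => x; rewrite [RHS]inE; apply/negbTE/negP => px.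
have ro y : y \in pend a -> ~~ writing Rw y.
  by move/ra; rewrite /key; case: (writing Rw y).
have rset0 y : y \in pend a -> Rw y = set0.
  by move/ro; rewrite /writing /lamw -leqNgt leqn0 cards_eq0 => /eqP.
have noconf y z : y \in pend a -> z \in pend a -> ~~ conf y z.
  move=> /rset0 Ry /rset0 Rz; rewrite /conflict negb_and; apply/orP; right.
  by apply/existsPn => r; rewrite Ry Rz !in_set0 andbF.
have alw u : a <= u < (a + T).+1 -> x \in hi u.
  move=> /andP[au ub]; have pu : x \in pend u by apply: pending_mono px.
  have xT : x \in hT u.
    apply: hatT_minimal => // y py; rewrite /key.
    by rewrite !(negbTE (ro _ (pending_mono au _))).
  have /orP[//|/exists_inP[y /high_hatT/hatT_pending py]] := hatT_high_or_blocked xT.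
  by rewrite (negbTE (noconf _ _ _ _)) //; apply: (pending_mono au).
have := leq_sum_high_tau x a (a + T).+1.
rewrite big_nat; under eq_bigr => u hu do rewrite alw //.
by rewrite -big_nat sum_nat_const_nat muln1; have := tT x; lia.
Qed.

End Run.

(** * Load bounds from an offline schedule *)

Section Schedule.

Variables (n s : nat) (Rr Rw : 'I_n -> {set 'I_s}) (tau sigma : 'I_n -> nat).
Hypothesis valid : valid_schedule Rr Rw tau sigma.

Local Notation M := (sched_makespan tau sigma).

Lemma finish_le_makespan x : sigma x + tau x <= M.
Proof. exact: (leq_bigmax (F := fun x => sigma x + tau x)). Qed.

Lemma tau_le_makespan x : tau x <= M.
Proof. exact: leq_trans (leq_addl _ _) (finish_le_makespan x). Qed.

Lemma tau_sum_slots x : tau x = \sum_(0 <= u < M) (sigma x <= u < sigma x + tau x).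
Proof.
rewrite -[LHS]muln1 -{1}[tau x](addKn (sigma x)) -sum_nat_const_nat.
rewrite (big_nat_widen _ _ _ _ _ (finish_le_makespan x)).
rewrite (big_nat_widenl _ _ _ _ _ (leq0n (sigma x))) big_mkcond /=.
by apply: eq_bigr => u _; rewrite andbC; case: (_ && _).
Qed.

(** Writers of [r] conflict pairwise, so at most one of them occupies each of the [M] time slots. *)
Lemma resource_load r : \sum_(x | r \in Rw x) tau x <= M.
Proof.
under eq_bigr => x _ do rewrite tau_sum_slots.
rewrite exchange_big /= -{2}[M]subn0 -[X in _ <= X]muln1 -sum_nat_const_nat.
apply: leq_sum => u _.
case: (pickP [pred x | (r \in Rw x) && (sigma x <= u < sigma x + tau x)]) => [x /=|no].
  case/andP => rx ux; rewrite (bigD1 x) //= ux big1 // => y /andP[ry yx].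
  have cxy : conflict Rr Rw x y.
    by rewrite /conflict eq_sym yx; apply/existsP; exists r; rewrite rx inE ry orbT.
  by have := valid cxy; lia.
by rewrite big1 // => x rx; have := no x; rewrite /= rx /= => ->.
Qed.

Lemma writers_load y : \sum_(x | writes_into Rr Rw x y) tau x <= lam Rr Rw y * M.
Proof.
rewrite /lam -sum_nat_const.
apply: (@leq_trans (\sum_(r in Defs.Rset Rr Rw y) \sum_(x | r \in Rw x) tau x)); last first.
  by apply: leq_sum => r _; apply: resource_load.
rewrite (exchange_big_dep xpredT) //= big_mkcond; apply: leq_sum => x _.
case: ifP => // /existsP[r /andP[rx ry]].
by rewrite (bigD1 r) /=; [exact: leq_addr | rewrite ry rx].
Qed.

(** Summing [resource_load] over all resources counts [tau x] once per resource that [x] writes. *)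
Lemma write_volume (A : {set 'I_n}) : \sum_(x in A) lamw Rw x * tau x <= s * M.
Proof.
apply: (@leq_trans (\sum_(r < s) \sum_(x | r \in Rw x) tau x)); last first.
  rewrite -[X in X * _]card_ord -sum_nat_const.
  by apply: leq_sum => r _; apply: resource_load.
rewrite (exchange_big_dep xpredT) //= big_mkcond; apply: leq_sum => x _.
by case: ifP => // _; rewrite sum_nat_const.
Qed.

End Schedule.

(** * Real arithmetic and telescoping costs *)

Lemma INR_mul a b : INR (a * b)%N = (INR a * INR b)%R.
Proof. exact: mult_INR. Qed.

Lemma INR_add a b : INR (a + b)%N = (INR a + INR b)%R.
Proof. exact: plus_INR. Qed.

Lemma INR_exp2 k : INR (2 ^ k)%N = (2 ^ k)%R.
Proof. by elim: k => //= k IH; rewrite expnS INR_mul IH. Qed.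

Lemma leq_INR a b : a <= b -> (INR a <= INR b)%R.
Proof. by move/leP; apply: le_INR. Qed.

Lemma floor_log2 (x : R) : (1 <= x)%R -> exists k : nat, (2 ^ k <= x < 2 ^ k.+1)%R.
Proof.
move=> x1; have [m xm] : exists m : nat, (x < 2 ^ m)%R.
  have [|m Hm] := Pow_x_infinity 2 _ (x + 1)%R; first by rewrite Rabs_right; lra.
  exists m; have := Hm m (le_n m).
  by rewrite Rabs_right; [lra | apply/Rle_ge/pow_le; lra].
elim: m xm => [|m IH] xm; first by move: xm => /=; lra.
by case: (Rlt_le_dec x (2 ^ m)) => [/IH|mx] //; exists m.
Qed.

(** [H] is a potential whose increments bound the costs of the single steps. *)
Lemma iterate_cost (Inv : nat -> nat -> Prop) (H : nat -> R) a m t :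
  (forall j u, a <= j < a + m -> Inv j u ->
     exists u', Inv j.+1 u' /\ (INR u' <= INR u + (H j.+1 - H j))%R) ->
  Inv a t -> exists t', Inv (a + m) t' /\ (INR t' <= INR t + (H (a + m)%N - H a))%R.
Proof.
elim: m => [|m IH] step It; first by exists t; rewrite addn0; split=> //; lra.
have [|//|u [Iu Hu]] := IH; first by move=> j u' jm; apply: step; lia.
have [|u' [Iu' Hu']] := step (a + m)%N u _ Iu; first by lia.
by exists u'; rewrite addnS; split=> //; lra.
Qed.

(** * Order and number of the subgroups *)

Section Groups.

Variables (n s : nat) (Rr Rw : 'I_n -> {set 'I_s}) (tau : 'I_n -> nat).
Variable surv : nat -> {set 'I_n}.

Local Notation reached := (reached Rr Rw tau surv).
Lemma reached0 t : reached (Some (0, 0)) t.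
Proof. by move=> x _; case: key => [[g j]|] //=; lia. Qed.

Lemma reached_next i j a t : a <= t -> reached (Some (i, j)) a ->
  subpending Rr Rw tau surv (Some (i, j)) t = set0 -> reached (Some (i, j.+1)) t.
Proof.
move=> le_at ra sp0 x px; have := reached_mono le_at ra px.
have : x \notin subpending Rr Rw tau surv (Some (i, j)) t by rewrite sp0 inE.
rewrite inE px /=; case: key => [[g h]|] //= neq.
have : ~~ ((g == i) && (h == j)) by apply: contra neq => /andP[/eqP-> /eqP->].
lia.
Qed.

Lemma lam_le x : lam Rr Rw x <= s.
Proof. by rewrite -[s in X in _ <= X]card_ord max_card. Qed.

Hypothesis lam_gt0 : forall x, 0 < lam Rr Rw x.

(** This crude bound suffices: passing through more indices only extends a convergent geometric
    series of costs. *)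
Lemma sub_le x : sub Rr Rw x <= s.
Proof.
apply: leq_trans (lam_le x); apply: leq_trans (trunc_logP (ltnSn 1) (lam_gt0 x)).
exact/ltnW/ltn_expl.
Qed.

Lemma reached_next_group i j t : s < j -> reached (Some (i, j)) t -> reached (Some (i.+1, 0)) t.
Proof.
move=> sj rt x /rt; rewrite /key; case: ifP => //= _.
by have := sub_le x; lia.
Qed.

Hypothesis tau_gt0 : forall x, 0 < tau x.
Hypothesis n_gt0 : 0 < n.

Lemma tau_le_max x : tau x <= tau_max tau.
Proof. exact: (leq_bigmax (F := tau)). Qed.

Lemma tau_min_gt0 : 0 < tau_min tau.
Proof.
apply: (big_ind (fun m => 0 < m)) => [|x y x0 y0|//]; last by rewrite leq_min x0.
exact: leq_trans (tau_gt0 (Ordinal n_gt0)) (tau_le_max _).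
Qed.

Lemma grp_lt_ell x : grp tau x < ell tau.
Proof.
rewrite /ell ltnS /ell_exp; case: ex_minnP => e; rewrite /ell_pred.
rewrite [_ == 0]eqn0Ngt tau_min_gt0 orbF => he _.
rewrite /grp -(trunc_expnK e (ltnSn 1)) leq_trunc_log //.
by rewrite -(mulnK (2 ^ e) tau_min_gt0) leq_div2r // (leq_trans (tau_le_max x)).
Qed.

Lemma reached_readonly t : reached (Some (ell tau, 0)) t -> reached None t.
Proof.
move=> rt x /rt; rewrite /key; case: ifP => //= _.
by have := grp_lt_ell x; lia.
Qed.

End Groups.

(** * Summing the phase durations *)

Section Makespan.

Variables (n s : nat) (Rr Rw : 'I_n -> {set 'I_s}) (tau : 'I_n -> nat).
Variables (beta : R) (surv I : nat -> {set 'I_n}) (sigma : 'I_n -> nat).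
Hypothesis n_gt0 : 0 < n.
Hypothesis lam_gt0 : forall x, 0 < lam Rr Rw x.
Hypothesis tau_gt0 : forall x, 0 < tau x.
Hypothesis beta_gt0 : (0 < beta)%R.
Hypothesis beta_le :
  forall x, writing Rw x -> (beta <= INR (lamw Rw x) / INR (lam Rr Rw x))%R.
Hypothesis run : clairvoyant_run Rr Rw tau surv I.
Hypothesis valid : valid_schedule Rr Rw tau sigma.

Local Notation M := (sched_makespan tau sigma).
Local Notation reached := (reached Rr Rw tau surv).

Lemma makespan_gt0 : 0 < M.
Proof. exact: leq_trans (tau_gt0 (Ordinal n_gt0)) (tau_le_makespan _ _ _). Qed.

Lemma key_some x i j : key Rr Rw tau x = Some (i, j) -> writing Rw x /\ sub Rr Rw x = j.
Proof. by rewrite /key; case: ifP => // wx [_ ->]. Qed.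

(** Members have [lam] at least [2 ^ j], hence write at least [beta * 2 ^ j] resources each;
    [write_volume] bounds the total. *)
Lemma work_le i j t :
  (INR (work Rr Rw tau surv (Some (i, j)) t) <= INR s / beta * INR M / 2 ^ j)%R.
Proof.
have pow_gt0 : (0 < 2 ^ j)%R by apply: pow_lt; lra.
set A := subpending Rr Rw tau surv (Some (i, j)) t.
suff : (beta * 2 ^ j * INR (work Rr Rw tau surv (Some (i, j)) t) <= INR (s * M)%N)%R.
  rewrite INR_mul => H; apply: (Rmult_le_reg_l (beta * 2 ^ j)); first exact: Rmult_lt_0_compat.
  by apply: Rle_trans H _; right; field; split; lra.
apply: Rle_trans (leq_INR (write_volume valid A)); rewrite /work -/A.
apply: (big_rec2 (fun a b : nat => (beta * 2 ^ j * INR a <= INR b)%R)) => [|x a b].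
  by rewrite /=; lra.
rewrite inE => /andP[_ /eqP/key_some[wx sx]] IH; rewrite !INR_add INR_mul Rmult_plus_distr_l.
apply: Rplus_le_compat => //; apply: Rmult_le_compat_r; first exact: pos_INR.
have lam0 : (0 < INR (lam Rr Rw x))%R by apply: lt_0_INR; apply/ltP.
have lamj : (2 ^ j <= INR (lam Rr Rw x))%R.
  by rewrite -INR_exp2 -sx; apply: leq_INR; apply: trunc_logP.
apply: (@Rle_trans _ (beta * INR (lam Rr Rw x))); first by apply: Rmult_le_compat_l; lra.
apply: (Rmult_le_reg_r (/ INR (lam Rr Rw x))); first exact: Rinv_0_lt_compat.
by rewrite Rmult_assoc Rinv_r ?Rmult_1_r; [apply: beta_le | lra].
Qed.

Lemma subgroup_time i j m a : reached (Some (i, j)) a ->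
  exists t, reached (Some (i, j.+1)) t /\
    (INR t <= INR a + (4 * INR m * 2 ^ j * INR M + INR s / beta * INR M / (2 ^ j * 2 ^ m)))%R.
Proof.
move=> ra; have D0 : 0 < 2 ^ j.+1 * M by rewrite muln_gt0 expn_gt0 makespan_gt0.
have wk x : key Rr Rw tau x = Some (i, j) -> writing Rw x by case/key_some.
(* Here [lam] is below [2 ^ j.+1], so [writers_load] permits [D = 2 ^ j.+1 * M]. *)
have [|w [sp0 hw]] := phase_end run tau_gt0 m ra D0 wk.
  move=> y /key_some[_ sy]; apply: leq_trans (writers_load valid y) _.
  by rewrite leq_mul2r -sy /sub ltnW ?orbT // trunc_log_ltn.
exists (a + m * (2 * (2 ^ j.+1 * M)) + w); split.
  by apply: (reached_next _ ra sp0); lia.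
have := Rle_trans _ _ _ (leq_INR hw) (work_le i j a).
rewrite !INR_add !INR_mul !INR_exp2 => H.
have pj : (0 < 2 ^ j)%R by apply: pow_lt; lra.
have pm : (0 < 2 ^ m)%R by apply: pow_lt; lra.
have : (INR w <= INR s / beta * INR M / (2 ^ j * 2 ^ m))%R.
  apply: (Rmult_le_reg_l (2 ^ m)) => //; apply: Rle_trans H _; right; field.
  by repeat split; lra.
by rewrite /=; lra.
Qed.

Local Notation Q := (sqrt (INR s / beta)).

(* With 2 ^ J <= Q < 2 ^ J.+1, subgroup j is halved 2 (J - j) times (never for
   j >= J).  H1 and H2 telescope the resulting costs below and above J. *)
Lemma group_time i a : (1 <= Q)%R -> reached (Some (i, 0)) a ->
  exists t, reached (Some (i.+1, 0)) t /\ (INR t <= INR a + 22 * Q * INR M)%R.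
Proof.
move=> Q1 ra; have [J [QJ JQ]] := floor_log2 Q1.
have QQ : (INR s / beta = Q * Q)%R.
  rewrite sqrt_sqrt //; apply: Rmult_le_pos; first exact: pos_INR.
  by left; apply: Rinv_0_lt_compat.
set q := sqrt (INR s / beta) in Q1 QJ JQ QQ *.
have pow_gt0 k : (0 < 2 ^ k)%R by apply: pow_lt; lra.
have XJ := pow_gt0 J; set X := (2 ^ J)%R in QJ XJ *.
have M0 : (0 <= INR M)%R by apply: pos_INR.
pose H1 j := (8 * INR M * ((INR J - INR j) * 2 ^ j + 2 * 2 ^ j) +
  q * q * INR M * 2 ^ j / (X * X))%R.
have [|//|b [rb Hb]] := @iterate_cost (fun j => reached (Some (i, j))) H1 0 J a.
  move=> j u; rewrite add0n => /andP[_ jJ] /(subgroup_time (2 * (J - j)))[t [rt Ht]].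
  exists t; split=> //; apply: Rle_trans Ht _; apply: Rplus_le_compat_l; right.
  rewrite /H1 QQ S_INR.
  have -> : (INR J = INR j + INR (J - j)%N)%R by rewrite -INR_add subnKC // ltnW.
  have -> : X = (2 ^ j * 2 ^ (J - j)%N)%R by rewrite -pow_add [(j + _)%coq_nat]subnKC // ltnW.
  rewrite INR_mul mul2n -addnn pow_add /=; field.
  by split; apply: Rgt_not_eq; apply: pow_gt0.
pose H2 j := (- 2 * (q * q * INR M) / 2 ^ j)%R.
(* After [s.+1] more subgroups the index exceeds [s], hence every value of [sub]. *)
have [|//|t [rt Ht]] := @iterate_cost (fun j => reached (Some (i, j))) H2 J s.+1 b.
  move=> j u _ /(subgroup_time 0)[t [rt Ht]].
  exists t; split=> //; apply: Rle_trans Ht _; apply: Rplus_le_compat_l; right.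
  by rewrite /H2 QQ /=; field; apply: Rgt_not_eq; apply: pow_gt0.
exists t; split; first by apply: reached_next_group rt => //; lia.
have V0 : (0 <= q * q * INR M)%R by nra.
have qX : (q * INR M * (q / X) <= 2 * q * INR M)%R.
  have : (q / X <= 2)%R.
    apply: (Rmult_le_reg_r X) => //; rewrite /Rdiv Rmult_assoc Rinv_l ?Rmult_1_r; last lra.
    by move: JQ => /=; rewrite -/X; lra.
  move=> qX2; apply: (@Rle_trans _ (q * INR M * 2)); last by lra.
  by apply: Rmult_le_compat_l => //; nra.
have XM : (X * INR M <= q * INR M)%R by nra.
have H1J : (H1 J <= 16 * q * INR M + 2 * q * INR M)%R.
  rewrite /H1 -/X; have -> : (q * q * INR M * X / (X * X) = q * INR M * (q / X))%R by field; lra.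
  by lra.
have H10 : (0 <= H1 0%N)%R.
  rewrite /H1 /=; apply: Rplus_le_le_0_compat; first by have := pos_INR J; nra.
  by apply: Rmult_le_pos; [lra | left; apply: Rinv_0_lt_compat; nra].
have H2J : (- (4 * q * INR M) <= H2 J)%R.
  rewrite /H2 -/X; have -> : (- 2 * (q * q * INR M) / X = - 2 * (q * INR M * (q / X)))%R.
    by field; lra.
  by lra.
have H2s : (H2 (J + s.+1)%N <= 0)%R.
  rewrite /H2 /Rdiv; have := Rinv_0_lt_compat _ (pow_gt0 (J + s.+1)%N).
  by set y := (/ _)%R => y0; have := Rmult_le_pos _ _ V0 (Rlt_le _ _ y0); lra.
(* Indices below [J] cost at most [18 * q * M], the others at most [4 * q * M]. *)
by rewrite add0n in Hb; lra.
Qed.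

Lemma makespan_bound : (1 <= Q)%R ->
  exists t, pending tau surv t = set0 /\
    (INR t <= (22 * INR (ell tau) * Q + 1) * INR M)%R.
Proof.
move=> Q1; pose H i := (INR i * (22 * Q * INR M))%R.
have [|t [rt Ht]] :=
    @iterate_cost (fun i => reached (Some (i, 0))) H 0 (ell tau) 0 _ (@reached0 _ _ _ _ _ _ _).
  move=> i u _ /(group_time Q1)[t [rt Ht]]; exists t; split=> //.
  by rewrite /H S_INR; lra.
(* The read-only phase takes the last [M] steps, the [+ 1] of the bound. *)
exists (t + M); split.
  apply: (readonly_phase_end run) => //; last exact: tau_le_makespan.
  exact: reached_readonly rt.
by move: Ht; rewrite INR_add /H add0n /=; lra.
Qed.

End Makespan.

Theorem mainTheorem5 (n s : nat) (Rr Rw : 'I_n -> {set 'I_s}) (tau : 'I_n -> nat)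
  (beta : R) (surv : nat -> {set 'I_n}) (I : nat -> {set 'I_n}) (sigma : 'I_n -> nat) :
  (0 < n)%N ->
  (forall i, 0 < lam Rr Rw i)%N ->
  (exists i, writing Rw i) ->
  (forall i, 0 < tau i)%N ->
  (exists2 i, writing Rw i & beta = Rdiv (INR (lamw Rw i)) (INR (lam Rr Rw i))) ->
  (forall i, writing Rw i -> Rle beta (Rdiv (INR (lamw Rw i)) (INR (lam Rr Rw i)))) ->
  clairvoyant_run Rr Rw tau surv I ->
  valid_schedule Rr Rw tau sigma ->
  exists t : nat,
    pending tau surv t = set0 /\
    Rle (INR t)
      (Rmult (Rplus (Rmult (Rmult (INR 32) (INR (ell tau))) (sqrt (Rdiv (INR s) beta))) (INR 1))
             (INR (sched_makespan tau sigma))).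
Proof.
move=> n0 lam0 _ tau0 [x wx betaE] beta_le run valid.
have lamx0 : (0 < INR (lam Rr Rw x))%R by apply: lt_0_INR; apply/ltP.
have lamwx0 : (0 < INR (lamw Rw x))%R by apply: lt_0_INR; apply/ltP.
have beta0 : (0 < beta)%R by rewrite betaE; apply: Rdiv_lt_0_compat.
(* This follows from [beta <= 1 <= s]. *)
have Q1 : (1 <= sqrt (INR s / beta))%R.
  rewrite -[X in (X <= _)%R]sqrt_1; apply: sqrt_le_1_alt.
  apply: (Rmult_le_reg_r beta) => //; rewrite /Rdiv Rmult_assoc Rinv_l; last lra.
  have s1 : (1 <= INR s)%R.
    by apply: (leq_INR (a := 1)); apply: leq_trans (lam0 x) (lam_le _ _ _).
  have : (INR (lamw Rw x) <= INR (lam Rr Rw x))%R by apply/leq_INR/subset_leq_card/subsetUr.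
  move=> wl; have : (beta <= 1)%R; last by lra.
  rewrite betaE; apply: (Rmult_le_reg_r (INR (lam Rr Rw x))) => //.
  by rewrite /Rdiv Rmult_assoc Rinv_l; lra.
have [t [pt Ht]] := makespan_bound n0 lam0 tau0 beta0 beta_le run valid Q1.
exists t; split=> //; apply: Rle_trans Ht _; apply: Rmult_le_compat_r; first exact: pos_INR.
have -> : INR 32 = 32%R by rewrite INR_IZR_INZ.
have : (0 <= INR (ell tau) * sqrt (INR s / beta))%R.
  by apply: Rmult_le_pos; [exact: pos_INR | lra].
by rewrite [INR 1]/=; lra.
Qed.
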